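(* For every integer $n\ge 2$, during a complete run of $\mathrm{AccelDesc}(n)$, the read operations are the test ''$d_q=2$'' and the statement ''$m\leftarrow d_q-1$''. Together they are executed a total of exactly $2p(n)-p(n-2)-2$ times.
   Context: $p(n)$ denotes the number of partitions of $n$, with $p(0)=1$. The procedure $\mathrm{AccelDesc}(n)$ (Zoghbi and Stojmenović's algorithm) operates on an array $d$ as follows and visits every descending composition of $n$ (a sequence of positive integers in nonincreasing order summing to $n$) exactly once: 1. $k\leftarrow1$; $q\leftarrow1$; $d_2,\dots,d_n\leftarrow 1$; $d_1\leftarrow n$; visit $\langle d_1\rangle$. 2. While $q\ne 0$: - If $d_q=2$: $k\leftarrow k+1$; $d_q\leftarrow 1$; $q\leftarrow q-1$. - Else: - $m\leftarrow d_q-1$; $n'\leftarrow k-q+1$; $d_q\leftarrow m$. - While $n'\ge m$: $q\leftarrow q+1$; $d_q\leftarrow m$; $n'\leftarrow n'-m$. - If $n'=0$: $k\leftarrow q$. - Else: $k\leftarrow q+1$; if $n'>1$ then $q\leftarrow q+1$ and $d_q\leftarrow n'$. - Visit $\langle d_1,\dots,d_k\rangle$. *)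

(* Defs.v *)
From mathcomp Require Import all_boot all_order all_algebra.

Set Implicit Arguments.
Unset Strict Implicit.
Unset Printing Implicit Defensive.

Definition desc_comp (n : nat) (s : seq nat) : bool :=
  [&& all (leq 1) s, sorted geq s & sumn s == n].

(* The bounds n on the length and on the parts lose nothing: a sequence of
   positive integers with sum n satisfies both. *)
Definition npartitions (n : nat) : nat :=
  \sum_(l < n.+1) #|[set t : l.-tuple 'I_n.+1 | desc_comp n (map val t)]|.

Definition array := nat -> nat.

Definition write (d : array) (i x : nat) : array :=
  fun j => if j == i then x else d j.

Record state := State { arr : array; kvar : nat; qvar : nat }.

(* The operations recorded in the trace of a run: the test d_q = 2, the
   statement m <- d_q - 1, and the visits. *)
Inductive event := TestTwo | ReadPred | Visit of seq nat.

Definition is_read (e : event) : bool :=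
  match e with
  | TestTwo | ReadPred => true
  | Visit _ => false
  end.

Definition visit (s : state) : event :=
  Visit [seq arr s i | i <- iota 1 (kvar s)].

(* Entries outside positions 1..n do not belong to the array; 0 is a filler. *)
Definition init (n : nat) : state :=
  State (fun i => if i == 1 then n else if 2 <= i <= n then 1 else 0) 1 1.

(* [fill m r d q r' d' q'] : started with n' = r, array d and index q, the
   inner while loop terminates with n' = r', array d' and index q'. *)
Inductive fill (m : nat) :
    nat -> array -> nat -> nat -> array -> nat -> Prop :=
| fill_stop r d q : r < m -> fill m r d q r d q
| fill_step r d q r' d' q' : m <= r ->
    fill m (r - m) (write d q.+1 m) q.+1 r' d' q' -> fill m r d q r' d' q'.

Definition finish (r : nat) (d : array) (q : nat) : state :=
  if r == 0 then State d q q
  else if 1 < r then State (write d q.+1 r) q.+1 q.+1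
  else State d q.+1 q.

(* One iteration of the outer loop.  Subtraction on nat never truncates on
   reachable states: there 1 <= q <= k and d_q >= 2. *)
Inductive body : state -> seq event -> state -> Prop :=
| body_two d k q : d q = 2 ->
    let s' := State (write d q 1) k.+1 (q - 1) in
    body (State d k q) [:: TestTwo; visit s'] s'
| body_else d k q r' d' q' : d q <> 2 ->
    let m := d q - 1 in
    fill m (k - q + 1) (write d q m) q r' d' q' ->
    let s' := finish r' d' q' in
    body (State d k q) [:: TestTwo; ReadPred; visit s'] s'.

Inductive loop : state -> seq event -> state -> Prop :=
| loop_stop s : qvar s = 0 -> loop s [::] s
| loop_step s tr1 s1 tr2 s2 : qvar s <> 0 ->
    body s tr1 s1 -> loop s1 tr2 s2 -> loop s (tr1 ++ tr2) s2.

(* [tr] is the full trace of a terminating execution of AccelDesc(n). *)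
Definition complete_run (n : nat) (tr : seq event) : Prop :=
  exists tr' s, loop (init n) tr' s /\ tr = visit (init n) :: tr'.

(* Main.v *)
Require Import Defs.
From mathcomp Require Import all_boot all_order all_algebra.
From mathcomp Require Import zify.

Set Implicit Arguments.
Unset Strict Implicit.
Unset Printing Implicit Defensive.

(** Let p(m, r) be the number of descending compositions of r with parts at
    most m.  With a fixed prefix, the algorithm goes through all of them in
    decreasing lexicographic order: first those with the part m, ending with
    m, 1, ..., 1, and then, after one more iteration of the outer loop, those
    with parts at most m - 1.  So the number of reads satisfies a recursion
    modelled on p(m, r) = p(m, r - m) + p(m - 1, r), which 2 p(m, r) -
    p(m, r - 2) - 2 solves: an iteration costs two reads, except that it costs
    one when the part 2 occurs. *)

(** * Descending compositions with bounded parts *)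

Definition bounded_desc_comp (m r : nat) (s : seq nat) : bool :=
  [&& all (leq 1) s, path geq m s & sumn s == r].

(* The fuel [f] suffices as soon as [m + r <= f]. *)
Fixpoint bounded_comps (f m r : nat) : seq (seq nat) :=
  if r == 0 then [:: [::]] else
  if m == 0 then [::] else
  if f is f'.+1 then
    (if m <= r then map (cons m) (bounded_comps f' m (r - m)) else [::])
    ++ bounded_comps f' m.-1 r
  else [::].

Definition bounded_count (m r : nat) : nat := size (bounded_comps (m + r) m r).

Lemma bounded_comps_fuel f g m r : m + r <= f -> m + r <= g ->
  bounded_comps f m r = bounded_comps g m r.
Proof.
elim: f g m r => [|f IH] [|g] m r /= hf hg.
- by [].
- by have [-> ->] : r = 0 /\ m = 0 by lia.
- by have [-> ->] : r = 0 /\ m = 0 by lia.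
case: eqP => // r0; case: eqP => // m0.
rewrite (IH g m.-1); try lia.
by case: (leqP m r) => // hmr; rewrite (IH g); try lia.
Qed.

Lemma bounded_count0 m : bounded_count m 0 = 1.
Proof. by rewrite /bounded_count; case: (m + 0). Qed.

Lemma bounded_count_ge m r : 0 < m <= r ->
  bounded_count m r = bounded_count m (r - m) + bounded_count m.-1 r.
Proof.
move=> hm; rewrite /bounded_count.
have -> : m + r = (m + r).-1.+1 by lia.
rewrite /=; have -> /= : (r == 0) = false by lia.
have -> /= : (m == 0) = false by lia.
have -> /= : m <= r by lia.
rewrite size_cat size_map.
by congr (_ + _); congr (size _); apply: bounded_comps_fuel; lia.
Qed.

Lemma bounded_count_lt m r : r < m -> bounded_count m r = bounded_count m.-1 r.
Proof.
move=> hm; have [->|r0] := eqVneq r 0; first by rewrite !bounded_count0.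
rewrite /bounded_count; have -> : m + r = (m + r).-1.+1 by lia.
rewrite /=; have -> /= : (r == 0) = false by lia.
have -> /= : (m == 0) = false by lia.
have -> /= : (m <= r) = false by lia.
by congr (size _); apply: bounded_comps_fuel; lia.
Qed.

Lemma bounded_count1 r : bounded_count 1 r = 1.
Proof.
elim: r => [|r IH]; first exact: bounded_count0.
by rewrite bounded_count_ge // subn1 IH.
Qed.

(** No part of a composition of [r] exceeds [r]. This identifies the final correction term, counted
    with bound [n], as p(n - 2). *)
Lemma bounded_count_cap m r : r <= m -> bounded_count m r = bounded_count r r.
Proof.
elim: m => [|m IH]; first by case: r.
by rewrite leq_eqVlt => /predU1P[-> //|hr]; rewrite bounded_count_lt //= IH.
Qed.

Lemma mem_bounded_comps f m r s : m + r <= f ->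
  (s \in bounded_comps f m r) = bounded_desc_comp m r s.
Proof.
rewrite /bounded_desc_comp.
elim: f m r s => [|f IH] m r s hf /=.
  have [-> ->] : r = 0 /\ m = 0 by lia.
  by case: s => [|x s] //=; rewrite inE /=; apply/esym/negbTE; lia.
case: eqP => [->|r0].
  by case: s => [|x s] //=; rewrite inE /=; apply/esym/negbTE; lia.
case: eqP => [->|m0].
  by case: s => [|x s] /=; rewrite in_nil; apply/esym/negbTE; lia.
rewrite mem_cat IH; last lia.
case: s => [|x s] /=.
  have -> : (0 == r) = false by lia.
  by rewrite orbF; case: ifP => // _; apply/negP => /mapP[].
(* The head decides the half of the list: head [m] occurs only in the first, any other head only in
   the second. *)
have [->|xm] := eqVneq x m.
  rewrite leqnn [m <= m.-1]leqNgt; have -> : m.-1 < m by lia.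
  rewrite !andbF orbF; case: (leqP m r) => hmr.
    rewrite mem_map; last by move=> ? ? [].
    rewrite IH; last lia.
    have -> : (sumn s == r - m) = (m + sumn s == r) by lia.
    by have -> : 0 < m by lia.
  by apply/esym/negbTE; lia.
have -> : (x <= m.-1) = (x <= m) by lia.
case: ifP => // _; case: mapP => // -[? _ [e _]].
by rewrite e eqxx in xm.
Qed.

Lemma bounded_comps_uniq f m r : m + r <= f -> uniq (bounded_comps f m r).
Proof.
elim: f m r => [|f IH] m r hf /=; first by case: eqP => // _; case: eqP.
case: eqP => // r0; case: eqP => // m0.
rewrite cat_uniq IH /=; last lia.
rewrite andbT; apply/andP; split.
  case: (leqP m r) => // hmr; rewrite map_inj_uniq; last by move=> ? ? [].
  by apply: IH; lia.
apply/hasPn => s; rewrite mem_bounded_comps; last lia.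
move=> /and3P[_ hp _]; apply/negP; case: ifP => // _ /mapP[t _ e].
by move: hp; rewrite e /=; lia.
Qed.

Lemma leq_sumn x s : x \in s -> x <= sumn s.
Proof.
by elim: s => //= y s IH; rewrite inE => /predU1P[->|/IH]; lia.
Qed.

Lemma size_le_sumn s : all (leq 1) s -> size s <= sumn s.
Proof. by elim: s => //= y s IH /andP[y0 /IH]; lia. Qed.

Lemma bounded_desc_compE n s : bounded_desc_comp n n s = desc_comp n s.
Proof.
rewrite /bounded_desc_comp /desc_comp; congr (_ && _).
case: eqP => [sn|]; last by rewrite !andbF.
by rewrite !andbT; case: s sn => //= x s sn; have -> : x <= n by lia.
Qed.

(** Both sides count the duplicate-free list [L], the left one sorted by length; no part and no
    length exceeds the sum [n], so the tuples miss nothing. *)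
Lemma npartitionsE n : npartitions n = bounded_count n n.
Proof.
rewrite /npartitions /bounded_count; set L := bounded_comps _ _ _.
have Lu : uniq L by apply: bounded_comps_uniq.
have LP s : (s \in L) = desc_comp n s.
  by rewrite mem_bounded_comps // bounded_desc_compE.
transitivity (\sum_(l < n.+1) count (fun s => size s == l) L).
  apply: eq_bigr => l _; rewrite cardE -size_filter.
  rewrite -(size_map (fun t : l.-tuple 'I_n.+1 => map val t)).
  apply/perm_size/uniq_perm.
  - rewrite map_inj_uniq ?enum_uniq // => t u /(inj_map val_inj) e.
    exact: val_inj.
  - exact: filter_uniq.
  move=> s; rewrite mem_filter LP; apply/mapP/andP.
    move=> [t]; rewrite mem_enum inE => ht ->; split=> //.
    by rewrite size_map size_tuple.
  move=> [/eqP hs hd].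
  have hb x : x \in s -> x < n.+1.
    by case/and3P: hd => _ _ /eqP <- /leq_sumn.
  have hsz : size (map inord s : seq 'I_n.+1) == l by rewrite size_map hs.
  have e : map val (map inord s : seq 'I_n.+1) = s.
    by rewrite -map_comp -[RHS]map_id; apply/eq_in_map => x /hb /= /inordK.
  by exists (Tuple hsz); rewrite ?mem_enum ?inE /= ?e.
under eq_bigr do rewrite -sum1_count big_mkcond /=.
rewrite exchange_big /= -sum1_size big_seq_cond [RHS]big_seq_cond.
apply: eq_bigr => s; rewrite andbT LP => /and3P[h1 _ /eqP h3].
have hs : size s < n.+1 by rewrite ltnS -h3 size_le_sumn.
rewrite (bigD1 (Ordinal hs)) //= eqxx big1 // => i hi.
by case: eqP => // e; case/eqP: hi; apply: val_inj.
Qed.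

(** * Determinism of the execution *)

Lemma fill_functional m r d q r1 d1 q1 r2 d2 q2 :
  fill m r d q r1 d1 q1 -> fill m r d q r2 d2 q2 ->
  [/\ r1 = r2, d1 = d2 & q1 = q2].
Proof.
move=> H; elim: H r2 d2 q2 => {r d q r1 d1 q1}.
  by move=> r d q hr r2 d2 q2 H; inversion H; subst => //; lia.
move=> r d q r' d' q' hr _ IH r2 d2 q2 H; inversion H; subst; first lia.
exact: IH.
Qed.

Lemma fill_total m r d q : 0 < m -> exists r' d' q', fill m r d q r' d' q'.
Proof.
move=> m0; elim/ltn_ind: r d q => r IH d q.
case: (leqP m r) => hr; last by exists r, d, q; apply: fill_stop.
have [|r' [d' [q' H]]] := IH (r - m) _ (write d q.+1 m) q.+1; first lia.
by exists r', d', q'; apply: fill_step.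
Qed.

Lemma body_functional s tr1 s1 tr2 s2 :
  body s tr1 s1 -> body s tr2 s2 -> tr1 = tr2 /\ s1 = s2.
Proof.
move=> H1 H2; inversion H1; subst; inversion H2; subst => //.
by have [e1 e2 e3] := fill_functional H0 H9; rewrite /s' /s'0 e1 e2 e3.
Qed.

(** The guards of the rules exclude each other. Hence the count found for one terminating run holds
    for every complete run. *)
Lemma loop_functional s tr1 s1 tr2 s2 :
  loop s tr1 s1 -> loop s tr2 s2 -> tr1 = tr2.
Proof.
move=> H; elim: H tr2 s2 => {s tr1 s1}.
  by move=> s q0 tr2 s2 H; inversion H; subst.
move=> s tr1 s1 tr1' s1' q0 hb _ IH tr2 s2 H; inversion H; subst => //.
have [-> e] := body_functional hb H1; subst.
by rewrite (IH _ _ H2).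
Qed.

(** * Counting reads along a run *)

(** [loop] describes only terminated runs, so a partial run is encoded by its continuations: a run
    from [t] extends backwards to one from [s]. *)
Definition reaches (s : state) (c : nat) (t : state) : Prop :=
  forall tr u, loop t tr u ->
    exists2 tr', loop s tr' u & count is_read tr' = c + count is_read tr.

Lemma reaches_refl s : reaches s 0 s.
Proof. by move=> tr u H; exists tr. Qed.

Lemma reaches_trans s t u b c :
  reaches s b t -> reaches t c u -> reaches s (b + c) u.
Proof.
move=> H1 H2 tr v /H2[tr' /H1[tr'' hl e1] e2].
by exists tr''; rewrite // e1 e2 addnA.
Qed.

Lemma reaches_body s tr t : qvar s <> 0 -> body s tr t ->
  reaches s (count is_read tr) t.
Proof.
move=> q0 hb tr' u hl; exists (tr ++ tr'); last exact: count_cat.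
exact: loop_step hb hl.
Qed.

(* [d q.+1] may be arbitrary if [m <= r], since [fill] then overwrites it: in
   the induction it still holds the part that has just been exhausted. *)
Lemma reaches_ones N m r d q r' d' q' :
    2 <= m -> q + r <= N ->
    (forall i, q < i <= N -> (i != q.+1) || (r < m) -> d i = 1) ->
    fill m r d q r' d' q' ->
  exists d2 c, [/\ forall i, i <= q -> d2 i = d i,
    forall i, q < i <= N -> d2 i = 1,
    reaches (finish r' d' q') c (State d2 (q + r) q) &
    c + 2 + (if 2 <= r then bounded_count m (r - 2) else 0)
      = 2 * bounded_count m r].
Proof.
(* The recursion passes to [(m, r - m)] and [(m - 1, r)]; both lower [m + r]. *)
have [w] := ubnP (m + r).
elim: w m r d q r' d' q' => // w IH m r d q r' d' q' hw m2 hN hd hf.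
inversion hf as [? ? ? lt_rm|? ? ? ? ? ? le_mr hf']; subst.
  have [m3|m3] := leqP 3 m; last first.
    exists d', 0; split=> //.
    - by move=> i hi; apply: hd => //; rewrite lt_rm orbT.
    - have [->|->] : r' = 0 \/ r' = 1 by lia.
        rewrite addn0; exact: reaches_refl.
      rewrite addn1; exact: reaches_refl.
    have -> : 1 < r' = false by lia.
    have -> : m = 2 by lia.
    by rewrite bounded_count_lt ?bounded_count1 //; lia.
  (* No part [m] fits, so the bound can drop to [m - 1]. If the remainder is exactly [m - 1],
     [finish] writes the very part that the inner loop for [m - 1] would write. *)
  have [r1 [d1 [q1 [hf1 e1]]]] : exists r1 d1 q1,
      fill m.-1 r' d' q' r1 d1 q1 /\ finish r' d' q' = finish r1 d1 q1.
    have [hlt|hge] := ltnP r' m.-1.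
      by exists r', d', q'; split=> //; apply: fill_stop.
    have er : r' = m.-1 by lia.
    exists 0, (write d' q'.+1 r'), q'.+1; split.
      rewrite -er; apply: fill_step => //; rewrite subnn.
      by apply: fill_stop; lia.
    rewrite /finish eqxx; have -> : (r' == 0) = false by lia.
    by have -> : 1 < r' by lia.
  rewrite e1.
  have [||||d2 [c [h1 h2 h3 h4]]] := IH _ _ _ _ _ _ _ _ _ _ _ hf1; try lia.
    by move=> i hi _; apply: hd => //; rewrite lt_rm orbT.
  exists d2, c; split=> //.
  rewrite (bounded_count_lt lt_rm) -h4; congr (_ + _); case: ifP => // _.
  by rewrite [LHS]bounded_count_lt //; lia.
have [||||d2 [c [h1 h2 h3 h4]]] := IH _ _ _ _ _ _ _ _ _ _ _ hf'; try lia.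
  move=> i hi _; rewrite /write; have -> : (i == q.+1) = false by lia.
  by apply: hd; lia.
have eq1 : d2 q.+1 = m by rewrite h1 // /write eqxx.
have [m3|m3] := leqP 3 m; last first.
  (* The part 2 at [q.+1] becomes 1, 1 at the cost of one read, and only ones remain beyond [q]. *)
  have em : m = 2 by lia.
  exists (write d2 q.+1 1), (c + 1); split.
  - move=> i hi; rewrite /write; have -> : (i == q.+1) = false by lia.
    by rewrite h1 /write; [case: eqP; lia|lia].
  - move=> i hi; rewrite /write; case: eqP => // ne; apply: h2; lia.
  - apply: (reaches_trans h3).
    have := reaches_body _ (@body_two d2 (q.+1 + (r - m)) q.+1 _).
    rewrite /= subn1; have -> : (q.+1 + (r - m)).+1 = q + r by lia.
    by apply; rewrite // eq1.
  have e1 := @bounded_count_ge m r; move: h4 e1; rewrite em bounded_count1.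
  have -> : 1 < r by lia.
  case: ifP => h h4 e1; last first.
    move: h4 e1; have [->|->] : r - 2 = 0 \/ r - 2 = 1 by lia.
      rewrite bounded_count0; lia.
    rewrite (@bounded_count_lt 2 1) // bounded_count1; lia.
  have := @bounded_count_ge 2 (r - 2); rewrite bounded_count1; lia.
have [|r1 [d1 [q1 hf1]]] :=
  @fill_total (d2 q.+1 - 1) (q.+1 + (r - m) - q.+1 + 1)
     (write d2 q.+1 (d2 q.+1 - 1)) q.+1; first lia.
have hb := body_else _ hf1.
(* Lowering the exhausted part to [m - 1] is the first step of an inner loop for [m - 1] that starts
   at [q] with all of [r]; what is left then is [r - (m - 1)], the value of k - q + 1. *)
have hf2 : fill m.-1 r d2 q r1 d1 q1.
  apply: fill_step; first lia.
  move: hf1; rewrite eq1.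
  have -> : m - 1 = m.-1 by lia.
  by have -> : q.+1 + (r - m) - q.+1 + 1 = r - m.-1 by lia.
have [||||d3 [c3 [k1 k2 k3 k4]]] := IH _ _ _ _ _ _ _ _ _ _ _ hf2; try lia.
  by move=> i hi hi2; apply: h2; lia.
exists d3, (c + 2 + c3); split=> //.
- by move=> i hi; rewrite k1 // h1 /write; [case: eqP; lia|lia].
- apply: reaches_trans k3; apply: (reaches_trans h3).
  by apply: (reaches_body _ (hb _)) => //=; lia.
(* The counts for [r] and for [r - 2] split by the same recursion; when [r - 2 < m], the latter has
   no term with part [m]. *)
have e1 := @bounded_count_ge m r.
move: k4 h4; have -> : 1 < r by lia.
move=> k4; case: ifP => hr h4.
  have := @bounded_count_ge m (r - 2).
  have -> : r - 2 - m = r - m - 2 by lia.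
  lia.
by have := @bounded_count_lt m (r - 2); lia.
Qed.

(* Existence of a complete run is termination of AccelDesc(n). *)
Theorem theorem4p15 (n : nat) (hn : 2 <= n) :
  (exists tr : seq event, complete_run n tr) /\
  (forall tr : seq event, complete_run n tr ->
    ((count is_read tr)%:Z =
       2 * (npartitions n)%:Z - (npartitions (n - 2))%:Z - 2)%R).
Proof.
(* The initial state is cast as the outcome of an inner loop at index 0 with bound and remainder
   [n], which writes [n] at position 1. The run of [reaches_ones] then ends with [q = 0], where the
   outer loop stops. *)
pose d i := if 2 <= i <= n then 1 else 0.
have hf : fill n n d 0 0 (write d 1 n) 1.
  by apply: fill_step => //; rewrite subnn; apply: fill_stop; lia.
have [|i hi hi1|d2 [c [_ _ hr hc]]] := reaches_ones (N := n) hn _ _ hf => //.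
  by rewrite /d; have -> : 1 < i <= n by lia.
have [tr hl ec] := hr _ _ (@loop_stop (State d2 n 0) erefl).
rewrite -[finish _ _ _]/(init n) in hl.
split; first by exists (visit (init n) :: tr), tr, (State d2 n 0).
move=> _ [tr' [s [hl' ->]]]; rewrite (loop_functional hl' hl) /= ec /=.
move: hc; rewrite hn (@bounded_count_cap n (n - 2)) -?npartitionsE; lia.
Qed.
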